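(* Let $b$ be an even base, $B=b-1$ and $C=(B-1)/2$, and suppose that $\sigma(B)=C$ and that $C$ is prime. For integers $\omega\ge1$ and $\eta\ge1$ put $$N_\gamma(C;\omega)=\left\lfloor\frac1C\binom{\omega-1}{C-1}\right\rfloor,\qquad N_{k\gamma}(C;\eta)=\sum_{\omega=1}^{\eta-1}N_\gamma(C;\omega).$$ Let $n$ be a positive integer, let $N_{SC}$ be the number of symmetric cycles and $N_{AC}$ the number of almost-symmetric cycles (of length at least $2$) of the Kaprekar transformation $T_{b,n}$. Then $$N_{SC}=N_{k\gamma}\left(C;\frac n2\right)\ \text{ for even } n,\qquad N_{SC}=0\ \text{ for odd } n,$$ $$N_{AC}=\sum_{m=1}^{\lfloor(n-3)/(2(b-1))\rfloor}N_{k\gamma}\left(C;\frac{n-2Bm+B}{2}\right)\ \text{ for odd } n,$$ $$N_{AC}=\sum_{m=1}^{\lfloor(n-b-2)/(2(b-1))\rfloor}N_{k\gamma}\left(C;\frac{n-2Bm}{2}\right)\ \text{ for even } n.$$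
   Context: Integers with digit-count $n$ in base $b$ are identified with strings of exactly $n$ base-$b$ digits (leading zeros allowed). If $a_0\le a_1\le\cdots\le a_{n-1}$ are the base-$b$ digits of $x$ in ascending order, the Kaprekar transformation is $T_{b,n}(x)=\sum_{j=0}^{n-1}a_jb^j-\sum_{j=0}^{n-1}a_jb^{n-1-j}$, again regarded as an $n$-digit string. The Kaprekar index of $x$ is $\mathbf k=(k_0,\ldots,k_{B})$, where $k_i$ is the number of occurrences of the digit $i$ among the $n$ digits. A cycle of length $l\ge2$ is a set of $l$ distinct non-repdigit integers permuted cyclically by $T_{b,n}$ (a repdigit has all $n$ digits equal). A Kaprekar index is full if $k_i\ge1$ for $i=0,\ldots,B$. A full index is symmetric if $k_{B-i}=k_i$ for $i=0,1,\ldots,B$. A full index is almost-symmetric if $k_{B-i}=k_i$ for $i=1,\ldots,B-1$ and $k_0<k_B<k_0+\min\{k_i:1\le i\le B-1\}$. A cycle is symmetric (respectively almost-symmetric) if every member has a symmetric (respectively almost-symmetric) Kaprekar index. For any odd integer $r\ge3$, $\sigma(r)$ is the least positive integer such that $2^{\sigma(r)}\equiv\pm1\pmod r$. Empty sums equal $0$. *)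

(* Defs.v *)
From mathcomp Require Import all_boot.
From mathcomp Require cyclic.

Set Implicit Arguments.
Unset Strict Implicit.
Unset Printing Implicit Defensive.

(* The n base-b digits of x, least significant first, leading zeros kept.
   An n-digit string is an x : 'I_(b ^ n). *)
Definition digits (b n x : nat) : seq nat :=
  [seq (x %/ b ^ j) %% b | j <- iota 0 n].

Definition sorted_digits (b n x : nat) : seq nat := sort leq (digits b n x).

(* The truncated subtraction is exact: the first sum reads the digits in
   descending order, the second one in ascending order. *)
Definition kaprekar_nat (b n x : nat) : nat :=
  let a := sorted_digits b n x in
  \sum_(j < n) nth 0 a j * b ^ j - \sum_(j < n) nth 0 a j * b ^ (n - 1 - j).

Lemma sum_digits_lt (b n : nat) (f : nat -> nat) :
  0 < b -> (forall j, j < n -> f j < b) -> \sum_(j < n) f j * b ^ j < b ^ n.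
Proof.
move=> b0; elim: n => [|n IHn] fb; first by rewrite big_ord0 expn0.
rewrite big_ord_recr /=.
have IH := IHn (fun j lt_jn => fb j (ltnW lt_jn)).
apply: (@leq_trans (b ^ n + f n * b ^ n)); first by rewrite ltn_add2r.
by rewrite -mulSn expnS leq_mul2r fb ?orbT.
Qed.

Lemma kaprekar_subproof (b n : nat) (x : 'I_(b ^ n)) : kaprekar_nat b n x < b ^ n.
Proof.
rewrite /kaprekar_nat; apply: leq_ltn_trans (leq_subr _ _) _.
case: n x => [|n] x; first by rewrite big_ord0 expn0.
have b0 : 0 < b.
  by case: b x => // -[m] /=; rewrite exp0n.
apply: (@sum_digits_lt b n.+1 (nth 0 (sorted_digits b n.+1 x)) b0) => j lt_j.
have : nth 0 (sorted_digits b n.+1 x) j \in digits b n.+1 x.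
  rewrite -(mem_sort leq); apply: mem_nth.
  by rewrite size_sort size_map size_iota.
by case/mapP=> i _ ->; rewrite ltn_mod.
Qed.

Definition kaprekar (b n : nat) (x : 'I_(b ^ n)) : 'I_(b ^ n) :=
  Ordinal (kaprekar_subproof x).

(* The component k_i of the Kaprekar index, meaningful for i <= b - 1. *)
Definition kindex (b n x i : nat) : nat := count_mem i (digits b n x).

Definition repdigit (b n x : nat) : bool := constant (digits b n x).

(* S = {x, T x, ..., T^(l-1) x} and T^l x = x, with l = #|S| >= 2. *)
Definition is_cycle (b n : nat) (S : {set 'I_(b ^ n)}) : bool :=
  [&& 2 <= #|S|,
      [forall x in S, ~~ repdigit b n x] &
      [exists x in S,
         (S == [set iter j (@kaprekar b n) x | j : 'I_#|S|]) &&
         (iter #|S| (@kaprekar b n) x == x)]].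

(* An index (k_0, ..., k_B) is given by a function k : nat -> nat, of which
   only the values at 0, ..., B matter. *)
Definition full_index (B : nat) (k : nat -> nat) : bool :=
  [forall i : 'I_B.+1, 1 <= k i].

Definition symmetric_index (B : nat) (k : nat -> nat) : bool :=
  full_index B k && [forall i : 'I_B.+1, k (B - i) == k i].

(* min {k_i : 1 <= i <= B - 1}; for B >= 2 the initial value k_1 is itself one
   of the k_i of the range. *)
Definition inner_min (B : nat) (k : nat -> nat) : nat :=
  \big[minn/k 1]_(1 <= i < B) k i.

Definition almost_symmetric_index (B : nat) (k : nat -> nat) : bool :=
  [&& full_index B k,
      [forall i : 'I_B.+1, (1 <= i <= B - 1) ==> (k (B - i) == k i)] &
      k 0 < k B < k 0 + inner_min B k].

Definition symmetric_cycle (b n : nat) (S : {set 'I_(b ^ n)}) : bool :=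
  is_cycle S && [forall x in S, symmetric_index b.-1 (kindex b n x)].

Definition almost_symmetric_cycle (b n : nat) (S : {set 'I_(b ^ n)}) : bool :=
  is_cycle S && [forall x in S, almost_symmetric_index b.-1 (kindex b n x)].

Definition N_SC (b n : nat) : nat :=
  #|[set S : {set 'I_(b ^ n)} | symmetric_cycle S]|.

Definition N_AC (b n : nat) : nat :=
  #|[set S : {set 'I_(b ^ n)} | almost_symmetric_cycle S]|.

(* 2 ^ s is congruent to 1 or to -1 modulo r. *)
Definition pow2_pm1 (r s : nat) : bool :=
  (2 ^ s == 1 %[mod r]) || (r %| 2 ^ s + 1).

Lemma sigma_subproof (r : nat) : exists s, (0 < s) && (odd r ==> pow2_pm1 r s).
Proof.
have [r_odd|r_even] := boolP (odd r); last by exists 1.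
exists (totient r); rewrite totient_gt0 odd_gt0 //= /pow2_pm1.
by rewrite cyclic.Euler_exp_totient ?eqxx // coprime2n.
Qed.

(* The least s >= 1 with 2 ^ s = 1 or -1 modulo r, for odd r; 1 for even r. *)
Definition sigma (r : nat) : nat := ex_minn (sigma_subproof r).

Definition N_gamma (C w : nat) : nat := 'C(w - 1, C - 1) %/ C.

Definition N_kgamma (C eta : nat) : nat := \sum_(1 <= w < eta) N_gamma C w.

(* Main.v *)
(* Write B = 2C + 1 and d = k_B - k_0. Sorting the digits and subtracting shows that
   T preserves the indices with k_{B-i} = k_i > d for 0 < i < B, fixes k_0 and k_B,
   and moves the count k_i of the digits +-i modulo B to the digits +-2i: the
   differences of mirrored sorted digits are B - 2i, with multiplicity k_i - d (k_0
   for i = 0), and B - 2i - 1, with multiplicity d, and the borrows do not change the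
   multiset that results. As sigma(B) = C, doubling permutes the C classes {i, -i}
   cyclically, so T^C fixes the index and, C being prime, the cycles of T on these
   numbers have length C; T x depends only on the index of x, so they correspond to
   the nonconstant index data (k_0, d, k_1, ..., k_C) up to rotation. With
   k_i = d + h_i the condition on n is n = 2 (k_0 + h_1 + ... + h_C) + B d, and the
   nonconstant compositions of w into C positive parts form N_gamma(C; w) orbits. *)
Require Import Defs.
From mathcomp Require Import all_boot.
From mathcomp Require Import zify.

Set Implicit Arguments.
Unset Strict Implicit.
Unset Printing Implicit Defensive.

(** * Digit strings *)

Lemma size_digits b n x : size (digits b n x) = n.
Proof. by rewrite size_map size_iota. Qed.

Lemma digits_lt b n x : 0 < b -> all (gtn b) (digits b n x).
Proof. by move=> b0; apply/allP=> _ /mapP[i _ ->]; rewrite /= ltn_mod. Qed.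

Lemma digitsS b n x : digits b n.+1 x = x %% b :: digits b n (x %/ b).
Proof.
rewrite /digits /= expn0 divn1 (iotaDl 1 0 n) -map_comp; congr (_ :: _).
by apply: eq_map => j /=; rewrite add1n expnS divnMA.
Qed.

Definition digit_value (b : nat) (s : seq nat) : nat :=
  \sum_(j < size s) nth 0 s j * b ^ j.

Lemma digit_value_cons b v s : digit_value b (v :: s) = v + b * digit_value b s.
Proof.
rewrite /digit_value /= big_ord_recl /= expn0 muln1 big_distrr /=.
by congr (_ + _); apply: eq_bigr => j _; rewrite /= /bump /= add1n expnS mulnCA.
Qed.

Lemma digit_value_cat b s t :
  digit_value b (s ++ t) = digit_value b s + b ^ size s * digit_value b t.
Proof.
elim: s => [|v s IHs] /=; first by rewrite [digit_value b [::]]big_ord0 mul1n.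
by rewrite !digit_value_cons IHs expnS mulnDr addnA mulnA.
Qed.

Lemma digit_value_lt b s : all (gtn b) s -> digit_value b s < b ^ size s.
Proof.
elim: s => [|v s IHs] /=; first by rewrite /digit_value big_ord0.
by case/andP=> vb /IHs; rewrite digit_value_cons expnS; nia.
Qed.

Lemma digits_value b s : all (gtn b) s -> digits b (size s) (digit_value b s) = s.
Proof.
elim: s => [//|v s IHs] /= /andP[vb sb]; have b0 : 0 < b by lia.
rewrite digitsS digit_value_cons mulnC addnC modnMDl divnMDl // modn_small //.
by rewrite divn_small // addn0 IHs.
Qed.

(** [digit_value] is linear in the entries, which need not be digits; subtractions can thus be
    stated as additions. *)
Lemma digit_value_map_add (T : Type) b (f g h : T -> nat) (w : seq T) :
  all (fun q => f q + g q == h q) w ->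
  digit_value b (map f w) + digit_value b (map g w) = digit_value b (map h w).
Proof.
elim: w => [|q w IHw] /=; first by rewrite /digit_value big_ord0.
by case/andP=> /eqP <- /IHw; rewrite !digit_value_cons => <-; lia.
Qed.

Lemma digit_value_nseq_pred b m :
  0 < b -> (digit_value b (nseq m b.-1)).+1 = b ^ m.
Proof.
move=> b0; elim: m => [|m IHm] /=; first by rewrite /digit_value big_ord0.
by rewrite digit_value_cons expnS -IHm; nia.
Qed.

Lemma sorted_digits_eq b n x a :
  sorted leq a -> perm_eq (digits b n x) a -> sorted_digits b n x = a.
Proof.
move=> a_sorted eq_a; apply: (sorted_eq leq_trans anti_leq) => //.
  exact: sort_sorted leq_total _.
by rewrite perm_sort.
Qed.

Lemma kaprekar_nat_sorted b n x a :
  sorted_digits b n x = a ->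
  kaprekar_nat b n x = digit_value b a - digit_value b (rev a).
Proof.
move=> def_a; have sz_a : size a = n by rewrite -def_a size_sort size_digits.
rewrite /kaprekar_nat def_a /digit_value size_rev sz_a; congr (_ - _).
rewrite [RHS](reindex_inj rev_ord_inj); apply: eq_bigr => j _ /=.
have jn := ltn_ord j.
by rewrite nth_rev sz_a; [congr (nth _ _ _ * b ^ _); lia | lia].
Qed.

Lemma sum_count_mem b s : all (gtn b) s -> \sum_(v < b) count_mem (v : nat) s = size s.
Proof.
elim: s => [|u s IHs] /=; first by rewrite big1.
case/andP=> ub /IHs <-; rewrite big_split -add1n /=; congr (_ + _).
rewrite (bigD1 (Ordinal ub)) //= eqxx big1 // => v /negPf.
by rewrite eq_sym -val_eqE /= => ->.
Qed.

Lemma perm_eq_count_lt b s t : all (gtn b) s -> all (gtn b) t ->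
  (forall v, v < b -> count_mem v s = count_mem v t) -> perm_eq s t.
Proof.
move=> sb tb eq_st; apply/allP=> v; rewrite mem_cat => v_st; apply/eqP/eq_st.
by case/orP: v_st => [/(allP sb)|/(allP tb)].
Qed.

Lemma count_nseq_eq (T : eqType) (v u : T) m : count_mem v (nseq m u) = (v == u) * m.
Proof. by rewrite count_nseq /= eq_sym. Qed.

(* The index with k_B = k_0 + d, where d < min {k_i : 1 <= i <= B - 1}: it is
   symmetric for d = 0, and almost-symmetric for d > 0. *)
Definition skew_index (B d : nat) (k : nat -> nat) : bool :=
  [&& 0 < k 0, k B == k 0 + d &
      [forall i : 'I_B, (0 < i) ==> (d < k i) && (k (B - i) == k i)]].

Lemma skew_indexP B d k :
  reflect [/\ 0 < k 0, k B = k 0 + d &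
              forall i, 0 < i < B -> d < k i /\ k (B - i) = k i]
          (skew_index B d k).
Proof.
apply: (iffP and3P) => [[k0 /eqP kB /forallP kP]|[k0 kB kP]]; split=> //.
- move=> i /andP[i0 iB].
  by have /implyP/(_ i0)/andP[? /eqP] := kP (Ordinal iB).
- exact/eqP.
apply/forallP=> i; apply/implyP=> i0.
by have [|-> ->] := kP i; rewrite ?i0 ?ltn_ord ?eqxx.
Qed.

(* The t-th lowest digit l and the t-th highest digit B - w of a skew index, as
   pairs (l, w), for l up to m. *)
Fixpoint mirror_pairs (k : nat -> nat) (d m : nat) : seq (nat * nat) :=
  if m is i.+1 then
    mirror_pairs k d i ++ nseq d (i.+1, i) ++ nseq (k i.+1 - d) (i.+1, i.+1)
  else nseq (k 0) (0, 0).

Lemma mirror_pairs_le k d m :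
  all (fun q => (q.1 <= m) && (q.2 <= q.1)) (mirror_pairs k d m).
Proof.
elim: m => [|m IHm] /=; first by rewrite all_nseq orbT.
rewrite !all_cat !all_nseq /= !leqnn leqnSn !orbT !andbT.
by apply: sub_all IHm => q; lia.
Qed.

Lemma pairwise_nseq (T : Type) (r : rel T) m q : r q q -> pairwise r (nseq m q).
Proof. by move=> rq; elim: m => //= m ->; rewrite all_nseq rq orbT. Qed.

Lemma mirror_pairs_sorted k d m :
  pairwise (fun q q' => (q.1 <= q'.1) && (q.2 <= q'.2)) (mirror_pairs k d m).
Proof.
elim: m => [|m IHm] /=; first exact: pairwise_nseq.
rewrite !pairwise_cat IHm !pairwise_nseq ?leqnn //= andbT.
apply/andP; split; apply/allrelP => q q'.
  move/(allP (mirror_pairs_le k d m)) => qP.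
  by rewrite mem_cat => /orP[] /nseqP[-> _] /=; lia.
by move=> /nseqP[-> _] /nseqP[-> _] /=; lia.
Qed.

(** A first component [v > 0] comes from the [d] pairs [(v, v - 1)] and the [k v - d] pairs
    [(v, v)]. *)
Lemma count_mirror_pairs1 k d m v : (forall i, 0 < i <= m -> d <= k i) ->
  count_mem v (map fst (mirror_pairs k d m)) = (v <= m) * k v.
Proof.
elim: m => [|m IHm] dk /=.
  by rewrite map_nseq count_nseq_eq leqn0; case: eqVneq => [->|].
rewrite !map_cat !count_cat !map_nseq !count_nseq_eq IHm /=;
  last by move=> i ?; apply: dk; lia.
have := dk m.+1 (leqnn m.+1); have [->|] := eqVneq v m.+1; nia.
Qed.

(** A second component [v] comes from [(v, v)] and from the [d] pairs [(v + 1, v)]. At [v = 0]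
    nothing is taken off the first kind; at [v = m] the second kind is not there yet. *)
Lemma count_mirror_pairs2 k d m v :
  (forall i, 0 < i <= m -> d <= k i) -> v <= m ->
  count_mem v (map snd (mirror_pairs k d m)) = k v + (v == 0) * d - (v == m) * d.
Proof.
elim: m v => [|m IHm] v dk vm /=.
  by rewrite map_nseq count_nseq_eq; move: vm; rewrite leqn0 => /eqP->; rewrite eqxx; lia.
have dk' i : 0 < i <= m -> d <= k i by move=> ?; apply: dk; lia.
rewrite !map_cat !count_cat !map_nseq !count_nseq_eq /=.
have := dk m.+1 (leqnn m.+1); have [->|ne_v] := eqVneq v m.+1.
  rewrite (count_memPn _); first by case: eqVneq => ?; lia.
  by apply/negP=> /mapP[q /(allP (mirror_pairs_le k d m)) qP]; lia.
rewrite IHm //; last by lia.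
have [->|] := eqVneq v m; last lia.
by have := dk' m; case: (m) => [|?] /=; lia.
Qed.

(** An odd sum [2i + 1] comes from [(i + 1, i)] only, an even sum [2i] from [(i, i)] only. *)
Lemma count_mirror_pairs_add k d m v :
  count_mem v (map (fun q => q.1 + q.2) (mirror_pairs k d m)) =
  if v == 0 then k 0 else
  if v <= m.*2 then (if odd v then d else k v./2 - d) else 0.
Proof.
elim: m => [|m IHm] /=.
  by rewrite map_nseq count_nseq_eq; case: v => [|v] /=; lia.
rewrite !map_cat !count_cat !map_nseq !count_nseq_eq IHm /=.
have [->|v0] := eqVneq v 0; first lia.
have [->|v1] := eqVneq v (m.+1 + m).
  rewrite (_ : _ <= m.*2 = false); last lia.
  rewrite (_ : _ <= m.+1.*2); last lia.
  by rewrite (_ : odd (m.+1 + m)); lia.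
have [->|v2] := eqVneq v (m.+1 + m.+1).
  rewrite (_ : _ <= m.*2 = false); last lia.
  rewrite (_ : _ <= m.+1.*2); last lia.
  by rewrite addnn odd_double doubleK; lia.
by rewrite (_ : (v <= m.+1.*2) = (v <= m.*2)); lia.
Qed.

(** * The Kaprekar map on skew indices *)

Lemma mirror_pairs_behead k d m :
  0 < k 0 -> exists s, mirror_pairs k d m = (0, 0) :: s.
Proof.
move=> k0; elim: m => [|m [s IHm]] /=; last by rewrite IHm; eexists.
by case: (k 0) k0 => // j _; eexists.
Qed.

Lemma mirror_pairs_belast k d m :
  0 < m -> d < k m -> exists s, mirror_pairs k d m = rcons s (m, m).
Proof.
case: m => //= m _ dk; rewrite (_ : k m.+1 - d = (k m.+1 - d.+1) + 1); last lia.
rewrite nseqD /= !catA cats1.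
by eexists.
Qed.

(* The d copies of C + 1 in the middle are those mirrored to each other. *)
Definition skew_digits (C d : nat) (k : nat -> nat) : seq nat :=
  let s := mirror_pairs k d C in
  map fst s ++ nseq d C.+1 ++ rev (map (fun q => C.*2.+1 - q.2) s).

Lemma count_map_subn (T : Type) B v (f : T -> nat) (s : seq T) :
  v <= B -> all (fun q => f q <= B) s ->
  count_mem v (map (fun q => B - f q) s) = count_mem (B - v) (map f s).
Proof.
move=> vB; elim: s => //= q s IHs /andP[fq /IHs ->]; congr (nat_of_bool _ + _).
by apply/eqP/eqP; lia.
Qed.

(** For [v > C] the reflected block contributes the count of the second component [B - v]: its
    surplus [d] at 0 is [k B - k 0], and its deficit [d] at [C] is made up by the middle copies of
    [C + 1]. *)
Lemma count_skew_digits C d k v :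
  0 < C -> skew_index C.*2.+1 d k -> v <= C.*2.+1 ->
  count_mem v (skew_digits C d k) = k v.
Proof.
move=> C0 /skew_indexP[k0 kB kP] vB; have Zle := mirror_pairs_le k d C.
have dk i : 0 < i <= C -> d <= k i by move=> ?; have [] := kP i; lia.
rewrite /skew_digits !count_cat count_rev count_nseq_eq count_mirror_pairs1 //.
rewrite count_map_subn //; last by apply: sub_all Zle => q; lia.
have [vC|Cv] := leqP v C.
  rewrite (count_memPn _); first by case: eqVneq; lia.
  by apply/negP=> /mapP[q /(allP Zle)]; lia.
rewrite count_mirror_pairs2 //; last lia.
have [->|vB'] := eqVneq v C.*2.+1.
  by rewrite subnn kB; case: eqVneq; case: eqVneq; lia.
have [dv kv] := kP v ltac:(lia); have [_ <-] := kP v ltac:(lia).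
have [_] := kP (C.*2.+1 - v) ltac:(lia).
by rewrite subKn //; do 3 (case: eqVneq => ?); nia.
Qed.

Lemma skew_digits_lt C d k : all (gtn C.*2.+2) (skew_digits C d k).
Proof.
have Zle := mirror_pairs_le k d C; rewrite /skew_digits !all_cat all_rev !all_map all_nseq.
apply/and3P; split; first by apply: sub_all Zle => q /=; lia.
  by rewrite /=; lia.
by apply: sub_all Zle => q /=; lia.
Qed.

Lemma skew_digits_sorted C d k : sorted leq (skew_digits C d k).
Proof.
have Zle := mirror_pairs_le k d C.
have Zs := mirror_pairs_sorted k d C.
rewrite (sorted_pairwise leq_trans) /skew_digits !pairwise_cat.
rewrite !pairwise_map allrel_catr pairwise_nseq //.
rewrite -andbA; apply/and5P; split=> //.
- by apply/allrelP=> _ _ /mapP[q /(allP Zle) qP ->] /nseqP[-> _]; lia.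
- apply/allrelP=> _ u /mapP[q /(allP Zle) qP ->].
  by rewrite mem_rev => /mapP[q' /(allP Zle) q'P ->]; lia.
- by apply: sub_pairwise Zs => q q' /andP[].
- apply/allrelP=> _ u /nseqP[-> _].
  by rewrite mem_rev => /mapP[q' /(allP Zle) q'P ->]; lia.
rewrite -(sorted_pairwise leq_trans) rev_sorted pairwise_sorted //.
by rewrite pairwise_map; apply: sub_pairwise Zs => q q' /= /andP[_]; lia.
Qed.

Lemma sorted_digits_skew C d n x :
  0 < C -> skew_index C.*2.+1 d (kindex C.*2.+2 n x) ->
  sorted_digits C.*2.+2 n x = skew_digits C d (kindex C.*2.+2 n x).
Proof.
move=> C0 kx; apply: sorted_digits_eq; first exact: skew_digits_sorted.
apply: (@perm_eq_count_lt C.*2.+2) => [||v v_lt]; first exact: digits_lt.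
  exact: skew_digits_lt.
by rewrite count_skew_digits.
Qed.

(** Subtracting [b ^ j - 1], the value of [j] digits [b - 1], amounts to moving one unit from the
    digit of weight [b ^ j] to the lowest digit. *)
Lemma digit_value_borrow b u v s t :
  digit_value b (u.+1 :: s ++ v :: t) + b ^ (size s).+1 =
  (digit_value b (u :: s ++ v.+1 :: t)).+1.
Proof. by rewrite !digit_value_cons !digit_value_cat !digit_value_cons expnS; lia. Qed.

(* Position by position, the difference of the sorted digits and their reversal,
   plus B at each position where the subtraction borrows, is a permutation of
   the digits of the difference: the borrows only exchange a 0 and a 1. *)
Lemma perm_digits_kaprekar C d n x :
  let m := map (fun q => q.1 + q.2) (mirror_pairs (kindex C.*2.+2 n x) d C) in
  0 < C -> skew_index C.*2.+1 d (kindex C.*2.+2 n x) ->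
  perm_eq (digits C.*2.+2 n (kaprekar_nat C.*2.+2 n x))
    (m ++ nseq d C.*2.+1 ++ rev (map (subn C.*2.+1) m)).
Proof.
set k := kindex _ _ _; set Z := mirror_pairs k d C => m C0 kS.
have def_a := sorted_digits_skew C0 kS.
have /skew_indexP[k0 kB kP] := kS; have [dC _] := kP C ltac:(lia).
have Zle := mirror_pairs_le k d C.
have [s def_s] := mirror_pairs_behead d C k0.
have [t def_t] := mirror_pairs_belast C0 dC.
rewrite -/Z in Zle def_s def_t.
(* [p] and [r] are what remains of the list without the 0 of the pair [(0, 0)] and the 1, which is
   [B - 2C], of the reflected pair [(C, C)]. *)
pose p := map (fun q => q.1 + q.2) s ++ nseq d C.*2.+1.
pose r := rev (map (fun q => C.*2.+1 - (q.1 + q.2)) t).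
have def_M : m ++ nseq d C.*2.+1 ++ rev (map (subn C.*2.+1) m) = 0 :: p ++ 1 :: r.
  rewrite catA {1}/m def_s /= /m -map_comp def_t map_rcons rev_rcons /=.
  by rewrite (_ : C.*2.+1 - (C + C) = 1) //; lia.
have def_L : digits C.*2.+2 n (kaprekar_nat C.*2.+2 n x) = 1 :: p ++ 0 :: r.
  have sz_L : size (1 :: p ++ 0 :: r) = n.
    have <- : size (skew_digits C d k) = n by rewrite -def_a size_sort size_digits.
    transitivity (size (0 :: p ++ 1 :: r)); first by rewrite /= !size_cat.
    by rewrite -def_M /skew_digits !(size_cat, size_rev, size_map, size_nseq).
  rewrite (kaprekar_nat_sorted def_a).
  suff <- : digit_value C.*2.+2 (1 :: p ++ 0 :: r) =
    digit_value C.*2.+2 (skew_digits C d k) - digit_value C.*2.+2 (rev (skew_digits C d k)).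
    rewrite -[X in digits _ X]sz_L digits_value //.
    have : all (gtn C.*2.+2) (0 :: p ++ 1 :: r).
      rewrite -def_M /m !all_cat all_rev !all_map all_nseq.
      by apply/and3P; split; [|by rewrite /= ltnSn orbT|];
        apply: (sub_all _ Zle) => q /=; lia.
    by rewrite /= !all_cat.
  have := digit_value_borrow C.*2.+2 0 0 p r; rewrite -def_M.
  have -> : (size p).+1 = size Z + d.
    by rewrite size_cat size_nseq size_map def_s.
  (* Digitwise, [l - (B - w) + B = l + w] in the low part and [(B - w) - l = B - (l + w)] in the
     high part, both put as additions. The middle digits cancel and leave the added [B]. *)
  have low : digit_value C.*2.+2 m + digit_value C.*2.+2 (map (fun q => C.*2.+1 - q.2) Z) =
      digit_value C.*2.+2 (map fst Z) + digit_value C.*2.+2 (map (fun=> C.*2.+1) Z).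
    pose h (q : nat * nat) := q.1 + C.*2.+1; rewrite [RHS](@digit_value_map_add _ _ _ _ h).
      apply: digit_value_map_add.
      by apply: sub_all Zle => q /=; rewrite /h; lia.
    by apply/allP=> q _ /=.
  have top : digit_value C.*2.+2 (rev (map (subn C.*2.+1) m)) +
      digit_value C.*2.+2 (rev (map fst Z)) =
      digit_value C.*2.+2 (rev (map (fun q => C.*2.+1 - q.2) Z)).
    rewrite -map_comp -!map_rev /=; apply: digit_value_map_add.
    by rewrite all_rev; apply: sub_all Zle => q /=; lia.
  have := digit_value_nseq_pred (size Z) (ltn0Sn C.*2.+1).
  have := digit_value_nseq_pred d (ltn0Sn C.*2.+1).
  have constZ (u : nat) : map (fun=> u) Z = nseq (size Z) u.
    by elim: (Z) => //= q Z' ->.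
  rewrite /skew_digits !rev_cat revK rev_nseq -catA !digit_value_cat.
  rewrite !(size_cat, size_rev, size_map, size_nseq) expnD.
  rewrite -/Z -top !mulnDr; move: low; rewrite constZ.
  move=> low nd nz; have : C.*2.+2 ^ size Z * C.*2.+2 ^ d =
    C.*2.+2 ^ size Z + C.*2.+2 ^ size Z * digit_value C.*2.+2 (nseq d C.*2.+1).
    by rewrite -nd mulnS.
  rewrite succnK in nz;lia.
rewrite def_L def_M.
by apply/permP=> f; rewrite /= !count_cat /=; lia.
Qed.

(** For [0 < v < B] exactly one of [v] and [B - v] is even, say [2i]; it contributes [k i - d] and
    the odd one [d], together [k i]. At [v = B] the middle block adds [d] to [k 0]. *)
Lemma kindex_kaprekar C d n x v :
  0 < C -> skew_index C.*2.+1 d (kindex C.*2.+2 n x) -> v <= C.*2.+1 ->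
  kindex C.*2.+2 n (kaprekar_nat C.*2.+2 n x) v =
  kindex C.*2.+2 n x
    (if v == C.*2.+1 then v else if odd v then (C.*2.+1 - v)./2 else v./2).
Proof.
move=> C0 kS vB; rewrite {1}/kindex (permP (perm_digits_kaprekar C0 kS)).
rewrite !count_cat count_rev count_nseq_eq.
have Zle := mirror_pairs_le (kindex C.*2.+2 n x) d C.
rewrite -map_comp (count_map_subn vB); last by apply: sub_all Zle => q /=; lia.
rewrite !count_mirror_pairs_add; have /skew_indexP[k0 kB kP] := kS.
have [->|vB'] := eqVneq v C.*2.+1; first by rewrite subnn kB /= ltnn; lia.
rewrite (_ : (_ - v == 0) = false) ?mul0n ?add0n /=; last lia.
rewrite (_ : v <= C.*2); last lia.
have [->|v0] := eqVneq v 0; first by rewrite /= subn0 ltnn addn0.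
rewrite (_ : _ - v <= C.*2); last lia.
rewrite oddB //= odd_double addTb; case: ifP => v_odd /=.
  by have [] := kP (C.*2.+1 - v)./2; lia.
by have [] := kP v./2; lia.
Qed.

(** An inner [i] and its mirror [B - i] have opposite parity and inherit the same count, that of
    half the even one. *)
Lemma kaprekar_skew C d n x :
  0 < C -> skew_index C.*2.+1 d (kindex C.*2.+2 n x) ->
  skew_index C.*2.+1 d (kindex C.*2.+2 n (kaprekar_nat C.*2.+2 n x)).
Proof.
move=> C0 kS; have /skew_indexP[k0 kB kP] := kS.
have E := kindex_kaprekar C0 kS; apply/skew_indexP; split.
- by rewrite E.
- by rewrite !E // eqxx.
move=> i iB; rewrite !E; try lia.
rewrite !ltn_eqF; try lia.
rewrite oddB; last lia.
rewrite /= odd_double addTb subKn; last lia.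
case: ifP => i_odd /=; first by have [] := kP (C.*2.+1 - i)./2; lia.
by have [] := kP i./2; lia.
Qed.

(** * Doubling modulo B *)

Lemma dvdn_odd_pow2M B j v : odd B -> (B %| 2 ^ j * v) = (B %| v).
Proof. by move=> B_odd; rewrite Gauss_dvdr // coprimeXr // coprimen2. Qed.

Lemma pow2_pm1_sub B i j :
  odd B -> i <= j -> 2 ^ i = 2 ^ j %[mod B] \/ B %| 2 ^ i + 2 ^ j ->
  pow2_pm1 B (j - i).
Proof.
move=> B_odd ij; rewrite -{1 2}(subnKC ij) expnD /pow2_pm1.
case=> [/eqP|]; last by rewrite -mulnS dvdn_odd_pow2M // addn1 => ->; rewrite orbT.
rewrite eq_sym -{2}[2 ^ i]muln1 eqn_mod_dvd; last by rewrite leq_mul2l expn_gt0 orbT.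
by rewrite -mulnBr dvdn_odd_pow2M // eqn_mod_dvd ?expn_gt0 // => ->.
Qed.

(** Pigeonhole: by minimality the powers [2 ^ 0, ..., 2 ^ (C - 1)] are distinct up to sign modulo
    [B], and the nonzero residues form only [C] classes up to sign. *)
Lemma pow2_pm1_cover C i :
  (forall s, 0 < s < C -> ~~ pow2_pm1 C.*2.+1 s) -> 0 < i <= C ->
  exists j, 2 ^ j %% C.*2.+1 = i \/ 2 ^ j %% C.*2.+1 = C.*2.+1 - i.
Proof.
set B := C.*2.+1 => minC iC; have B_odd : odd B by rewrite /= odd_double.
pose r j := 2 ^ j %% B.
have r_lt j : 0 < r j < B.
  rewrite ltn_mod andbT lt0n -/(dvdn B _) -[2 ^ j]muln1 dvdn_odd_pow2M //.
  by rewrite dvdn1; lia.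
have r_inj (j1 j2 : nat) : j1 <= j2 < C -> r j1 = r j2 \/ r j1 + r j2 = B -> j1 = j2.
  move=> j12 r12; apply/eqP; apply: contraT => ne_j.
  have /negP[] := minC (j2 - j1) ltac:(lia).
  apply: pow2_pm1_sub => //; first lia.
  case: r12 => r12; [by left | right].
  by rewrite /dvdn -modnDm -!/(r _) r12 modnn.
case: C @B minC iC B_odd @r r_lt r_inj => [|c] B minC iC B_odd r r_lt r_inj; first lia.
(* [f j] is the representative of the class of [2 ^ j] in 1, ..., [c + 1], lowered by one to fit the
   ordinal type. *)
pose f (j : 'I_c.+1) : 'I_c.+1 := inord ((minn (r j) (B - r j)).-1).
have f_val j : f j = (minn (r j) (B - r j)).-1 :> nat.
  by rewrite inordK //; have := r_lt j; rewrite /B; lia.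
have f_inj : injective f.
  move=> j1 j2 /(congr1 val) /=; rewrite !f_val => e.
  apply: val_inj => /=; have := (r_lt j1, r_lt j2).
  have [j1C j2C] := (ltn_ord j1, ltn_ord j2).
  wlog le12 : j1 j2 e j1C j2C / j1 <= j2.
    by move=> W [? ?]; have /orP[?|?] := leq_total j1 j2; [|symmetry]; apply: W.
  by move=> [? ?]; apply: r_inj; move: e; rewrite /B; lia.
have i_lt : i.-1 < c.+1 by lia.
have /codomP[j /(congr1 val) /= e] := injF_onto f_inj (Ordinal i_lt).
by exists j; rewrite -/(r j); rewrite f_val in e; have := r_lt j; move: e; rewrite /B; lia.
Qed.

Lemma skew_index_eq B d k k' :
  (forall i, i <= B -> k i = k' i) -> 0 < B -> skew_index B d k = skew_index B d k'.
Proof.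
move=> kk' B0; rewrite /skew_index !kk' //; congr [&& _, _ & _].
by apply: eq_forallb => i; have iB := ltn_ord i; rewrite !kk' //; lia.
Qed.

(** This is [kindex_kaprekar] followed forwards. A residue [w < B / 2] goes to the even [2w]; a
    larger one goes to the odd [2w - B], which inherits the count of [B - w], equal to that of
    [w]. *)
Lemma kindex_kaprekar_double C d n x v :
  0 < C -> skew_index C.*2.+1 d (kindex C.*2.+2 n x) -> ~~ (C.*2.+1 %| v) ->
  kindex C.*2.+2 n (kaprekar_nat C.*2.+2 n x) ((2 * v) %% C.*2.+1) =
  kindex C.*2.+2 n x (v %% C.*2.+1).
Proof.
move=> C0 kS; rewrite /dvdn -modnMmr; have := ltn_pmod v (ltn0Sn C.*2).
move: (v %% _) => w wB w0; have /skew_indexP[_ _ kP] := kS.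
have [lt_2w|le_2w] := ltnP (2 * w) C.*2.+1.
  rewrite modn_small // (kindex_kaprekar C0 kS) ?ltn_eqF; try lia.
  by rewrite mul2n odd_double doubleK.
rewrite -(subnK le_2w) modnDr modn_small; last lia.
rewrite (kindex_kaprekar C0 kS) ?ltn_eqF; try lia.
rewrite oddB // mul2n /= !odd_double /= -[w.*2]mul2n.
rewrite (_ : (_ - _)./2 = C.*2.+1 - w); last lia.
by have [] := kP w; lia.
Qed.

Lemma iter_kaprekar_skew C d n (x : 'I_(C.*2.+2 ^ n)) j :
  0 < C -> skew_index C.*2.+1 d (kindex C.*2.+2 n x) ->
  skew_index C.*2.+1 d (kindex C.*2.+2 n (iter j (@kaprekar _ n) x)).
Proof. by move=> C0 kS; elim: j => //= j IHj; apply: kaprekar_skew. Qed.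

Lemma kindex_kaprekar_ends C d n x v :
  0 < C -> skew_index C.*2.+1 d (kindex C.*2.+2 n x) -> (v == 0) || (v == C.*2.+1) ->
  kindex C.*2.+2 n (kaprekar_nat C.*2.+2 n x) v = kindex C.*2.+2 n x v.
Proof.
by move=> C0 kS /orP[] /eqP->; rewrite (kindex_kaprekar C0 kS) ?eqxx.
Qed.

Lemma kindex_iter_kaprekar C d n (x : 'I_(C.*2.+2 ^ n)) j v :
  0 < C -> skew_index C.*2.+1 d (kindex C.*2.+2 n x) -> ~~ (C.*2.+1 %| v) ->
  kindex C.*2.+2 n (iter j (@kaprekar _ n) x) ((2 ^ j * v) %% C.*2.+1) =
  kindex C.*2.+2 n x (v %% C.*2.+1).
Proof.
move=> C0 kS vB; elim: j => [|j IHj]; first by rewrite mul1n.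
rewrite /= expnS -mulnA (kindex_kaprekar_double C0 (iter_kaprekar_skew j C0 kS)) ?IHj //.
by rewrite dvdn_odd_pow2M // /= odd_double.
Qed.

(** [T ^ C] multiplies the inner positions by [2 ^ C], which is 1 or -1 modulo [B]; the mirror
    symmetry absorbs the sign. *)
Lemma kindex_iter_period C d n (x : 'I_(C.*2.+2 ^ n)) v :
  0 < C -> pow2_pm1 C.*2.+1 C -> skew_index C.*2.+1 d (kindex C.*2.+2 n x) ->
  v <= C.*2.+1 ->
  kindex C.*2.+2 n (iter C (@kaprekar _ n) x) v = kindex C.*2.+2 n x v.
Proof.
move=> C0 pC kS vB; have [v_end|v_mid] := boolP ((v == 0) || (v == C.*2.+1)).
  have fix_v j : kindex C.*2.+2 n (iter j (@kaprekar _ n) x) v = kindex C.*2.+2 n x v.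
    by elim: j => //= j <-; apply: (kindex_kaprekar_ends C0 (iter_kaprekar_skew j C0 kS)).
  exact: fix_v.
have vN : ~~ (C.*2.+1 %| v) by rewrite gtnNdvd //; lia.
have := kindex_iter_kaprekar C C0 kS vN; rewrite [v %% _]modn_small; last lia.
move=> <-; case/orP: pC => [/eqP pC|pC].
  by rewrite -modnMml pC modnMml mul1n modn_small //; lia.
have /skew_indexP[_ _ kP] := iter_kaprekar_skew C C0 kS.
have [_ <-] := kP v ltac:(lia); congr kindex.
(* With [u] the residue of [2 ^ C * v], [B] divides [u + v], which lies strictly between 0 and [2B];
   hence [u = B - v]. *)
have : 2 ^ C * v + v = 0 %[mod C.*2.+1].
  by apply/eqP; rewrite mod0n -mulSnr -addn1 -/(dvdn _ _) dvdn_mulr.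
rewrite -modnDml mod0n; move: (ltn_pmod (2 ^ C * v) (ltn0Sn C.*2)).
move: (_ %% _) => u uB /eqP; rewrite -/(dvdn _ _) => /dvdnP[q].
by case: q => [|[|q]]; nia.
Qed.

(** A fixed index satisfies [k (2v) = k v] modulo [B], so it is constant on the powers of 2, which
    reach every [i] up to sign. *)
Lemma kindex_fixed_constant C d n x i :
  0 < C -> (forall s, 0 < s < C -> ~~ pow2_pm1 C.*2.+1 s) ->
  skew_index C.*2.+1 d (kindex C.*2.+2 n x) ->
  (forall v, v <= C.*2.+1 ->
     kindex C.*2.+2 n (kaprekar_nat C.*2.+2 n x) v = kindex C.*2.+2 n x v) ->
  0 < i <= C -> kindex C.*2.+2 n x i = kindex C.*2.+2 n x 1.
Proof.
move=> C0 minC kS fix_k iC; have [j ij] := pow2_pm1_cover minC iC.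
have pow2_k : kindex C.*2.+2 n x (2 ^ j %% C.*2.+1) = kindex C.*2.+2 n x 1.
  elim: {i iC ij} j => [|j <-]; first by rewrite modn_small //; lia.
  rewrite expnS -fix_k; last by rewrite ltnW // ltn_pmod.
  apply: (kindex_kaprekar_double C0 kS).
  by rewrite -[2 ^ j]muln1 dvdn_odd_pow2M /= ?odd_double // dvdn1; lia.
rewrite -pow2_k; have /skew_indexP[_ _ kP] := kS.
by have [_ kC] := kP i ltac:(lia); case: ij => ->.
Qed.

(** * Periodic points and compositions *)

Lemma sum_skew_index C d k : skew_index C.*2.+1 d k ->
  \sum_(v < C.*2.+2) k v = (k 0).*2 + d + (\sum_(i < C) k i.+1).*2.
Proof.
case/skew_indexP=> k0 kB kP; rewrite -(big_mkord xpredT k).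
rewrite (@big_cat_nat _ _ _ C.+1) //=; last lia.
have -> : \sum_(C.+1 <= v < C.*2.+2) k v = \sum_(i < C.+1) k (C.*2.+1 - i).
  rewrite -{1}[C.+1]add0n big_addn (_ : C.*2.+2 - C.+1 = C.+1); last lia.
  rewrite big_nat_rev big_mkord; apply: eq_bigr => i _.
  by have iC := ltn_ord i; congr (k _); lia.
rewrite big_mkord -big_split big_ord_recl /= subn0 kB.
rewrite -[X in _ = _ + X]addnn -big_split /=.
rewrite (eq_bigr (fun i : 'I_C => k i.+1 + k i.+1)); first lia.
move=> i _; have iC := ltn_ord i; rewrite /bump /= add1n.
by have [] := kP i.+1; lia.
Qed.

Lemma sum_kindex b n x : 0 < b -> \sum_(v < b) kindex b n x v = n.
Proof. by move=> b0; rewrite sum_count_mem ?size_digits ?digits_lt. Qed.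

Lemma exists_kindex C d n k :
  0 < C -> skew_index C.*2.+1 d k -> \sum_(v < C.*2.+2) k v = n ->
  exists x : 'I_(C.*2.+2 ^ n), forall v, v <= C.*2.+1 -> kindex C.*2.+2 n x v = k v.
Proof.
move=> C0 kS sum_k; have s_lt := skew_digits_lt C d k.
have sz_s : size (skew_digits C d k) = n.
  rewrite -(sum_count_mem s_lt) -sum_k; apply: eq_bigr => v _.
  by rewrite count_skew_digits // -ltnS.
have := digit_value_lt s_lt; rewrite sz_s => x_lt.
exists (Ordinal x_lt) => v vB; rewrite /kindex /= -{1}sz_s digits_value //.
exact: count_skew_digits.
Qed.

Lemma kaprekar_eq b n (x y : 'I_(b ^ n)) :
  0 < b -> (forall v, v < b -> kindex b n x v = kindex b n y v) ->
  kaprekar x = kaprekar y.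
Proof.
move=> b0 xy; apply: val_inj; rewrite /= /kaprekar_nat.
suff -> : sorted_digits b n x = sorted_digits b n y by [].
apply: (sorted_eq leq_trans anti_leq); try exact: (sort_sorted leq_total).
rewrite perm_sort perm_sym perm_sort perm_sym.
by apply: perm_eq_count_lt xy; apply: digits_lt.
Qed.

(** If [p] does not divide [m], it is coprime to the factor [m + p] in [(m + p) 'C(m + p - 1, p - 1)
    = p 'C(m + p, p)]. If it does, consecutive ['C(m + p - 1, j)] are opposite modulo [p], so those
    with even [j] are 1; [p = 2] is separate. *)
Lemma bin_pred_prime_modn p m : prime p -> 'C(m + p - 1, p - 1) %% p = (p %| m).
Proof.
move=> p_pr; have p1 := prime_gt1 p_pr.
have diag j : (m + p) * 'C(m + p - 1, j) = j.+1 * 'C(m + p, j.+1).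
  by rewrite subn1 mul_bin_diag.
have [p_m|pNm] := boolP (p %| m); last first.
  apply/eqP; rewrite -/(dvdn _ _) -(@Gauss_dvdr _ (m + p)).
    by rewrite diag -subSn ?subSS ?subn0 ?dvdn_mulr // ltnW.
  by rewrite prime_coprime // dvdn_addl.
have dvd_step j : j.+1 < p -> p %| 'C(m + p - 1, j) + 'C(m + p - 1, j.+1).
  move=> jp; rewrite addnC -binS -(@Gauss_dvdr _ j.+1); last first.
    by rewrite prime_coprime // gtnNdvd.
  by rewrite (_ : (m + p - 1).+1 = m + p) -?diag ?dvdn_mulr ?dvdn_addl //; lia.
have alt j : j.*2 < p -> 'C(m + p - 1, j.*2) = 1 %[mod p].
  elim: j => [|j IHj] jp; first by rewrite bin0.
  have jp' : j.*2.+2 < p by rewrite doubleS in jp.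
  rewrite -IHj; last lia.
  have := dvd_step j.*2 ltac:(lia); have := dvd_step j.*2.+1 ltac:(lia).
  rewrite doubleS /dvdn => /eqP e1 /eqP e2; apply/eqP.
  by rewrite -(eqn_modDl 'C(m + p - 1, j.*2.+1)) e1 addnC e2.
have [p2|p_odd] := even_prime p_pr; last first.
  have := alt (p - 1)./2 ltac:(lia); rewrite [1 %% p]modn_small //.
  by rewrite (_ : (p - 1)./2.*2 = p - 1) => [->|]; last lia.
by move: p_m; rewrite p2 -[2 - 1]/1 bin1 /=; lia.
Qed.

(** The floor in [N_gamma] loses a remainder 1 exactly when [m + C] has a constant composition. *)
Lemma N_gamma_prime C m :
  prime C -> 'C(m + C - 1, C - 1) = C * N_gamma C (m + C) + (C %| m).
Proof.
by move=> C_pr; rewrite mulnC -bin_pred_prime_modn // -divn_eq.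
Qed.

Lemma constant_tuple (T : eqType) c (t : c.+1.-tuple T) :
  constant t = (t == [tuple of nseq c.+1 (tnth t ord0)]).
Proof.
case/tupleP: t => x t; rewrite (tnth_nth x) -val_eqE /= eqseq_cons eqxx /=.
by rewrite -[X in nseq X](size_tuple t); apply/all_pred1P/eqP.
Qed.

Lemma card_constant_partitions c m :
  #|[set t : c.+1.-tuple 'I_m.+1 | (\sum_(i <- t) (i : nat) == m) && constant t]| =
  (c.+1 %| m).
Proof.
have sum_nseq (u : 'I_m.+1) : \sum_(i <- nseq c.+1 u) (i : nat) = u * c.+1.
  by rewrite big_nseq iter_addn addn0.
have [/dvdnP[q def_m]|mN] := boolP (c.+1 %| m); last first.
  apply/eqP; rewrite cards_eq0; apply/eqP/setP => t; rewrite !inE constant_tuple.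
  apply/negP=> /andP[/eqP sum_t /eqP def_t]; case/negP: mN; apply/dvdnP.
  by exists (tnth t ord0); rewrite -[LHS]sum_t {1}def_t /= sum_nseq.
have q_lt : q < m.+1 by rewrite def_m; nia.
apply: eq_trans (cards1 [tuple of nseq c.+1 (Ordinal q_lt)]).
apply: eq_card => t; rewrite !inE constant_tuple.
apply/andP/eqP => [[/eqP sum_t /eqP def_t]|->].
  rewrite def_t; congr [tuple of nseq _ _]; apply: val_inj => /=.
  move: sum_t; rewrite {1}def_t /= sum_nseq [in RHS]def_m => /eqP.
  by rewrite eqn_pmul2r // => /eqP.
by rewrite /= sum_nseq /= -def_m.
Qed.

(** Lowering each part by one turns compositions of [m + C] into these tuples. The binomial
    coefficient counts all of them, and the constant one, if any, is the remainder in
    [N_gamma_prime]. *)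
Lemma card_nonconstant_partitions C m : prime C ->
  #|[set t : C.-tuple 'I_m.+1 | (\sum_(i <- t) (i : nat) == m) && ~~ constant t]| =
  C * N_gamma C (m + C).
Proof.
case: C => // c C_pr; have := N_gamma_prime m C_pr.
rewrite (_ : m + c.+1 - 1 = c + m) ?subSS ?subn0; last lia.
rewrite -card_ord_partitions -card_constant_partitions.
rewrite -(cardsID [set t : c.+1.-tuple 'I_m.+1 | constant t]) addnC => /eqP.
rewrite (_ : _ :&: _ = [set t : c.+1.-tuple 'I_m.+1 |
    (\sum_(i <- t) (i : nat) == m) && constant t]); last first.
  by apply/setP=> t; rewrite !inE.
rewrite eqn_add2r => /eqP <-.
by apply: eq_card => t; rewrite !inE andbC.
Qed.

Lemma constant_tupleP (T : eqType) n (t : n.-tuple T) :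
  reflect (forall i j, tnth t i = tnth t j) (constant t).
Proof.
case: n t => [|c] t; first by rewrite tuple0; constructor=> -[].
rewrite constant_tuple; apply: (iffP eqP) => [-> i j|e].
  by rewrite /tnth !nth_nseq !ltn_ord.
by apply: eq_from_tnth => i; rewrite (e i ord0) {2}/tnth nth_nseq ltn_ord.
Qed.

Lemma skew_index_ext C d k k' :
  skew_index C.*2.+1 d k -> skew_index C.*2.+1 d k' -> k 0 = k' 0 ->
  (forall i, 0 < i <= C -> k i = k' i) -> forall v, v <= C.*2.+1 -> k v = k' v.
Proof.
move=> /skew_indexP[_ kB kP] /skew_indexP[_ kB' kP'] k0 kC v vB.
have [->//|v0] := eqVneq v 0; have [->|vB'] := eqVneq v C.*2.+1; first by rewrite kB kB' k0.
have [vC|Cv] := leqP v C; first by apply: kC; lia.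
have [_ <-] := kP v ltac:(lia); have [_ <-] := kP' v ltac:(lia).
by apply: kC; lia.
Qed.

Lemma kindex_constant_fixed C d n x :
  0 < C -> skew_index C.*2.+1 d (kindex C.*2.+2 n x) ->
  (forall i, 0 < i <= C -> kindex C.*2.+2 n x i = kindex C.*2.+2 n x 1) ->
  forall v, v <= C.*2.+1 ->
  kindex C.*2.+2 n (kaprekar_nat C.*2.+2 n x) v = kindex C.*2.+2 n x v.
Proof.
move=> C0 kS const_k; apply: (skew_index_ext (kaprekar_skew C0 kS) kS).
  exact: (kindex_kaprekar_ends C0 kS).
move=> i iC; rewrite (kindex_kaprekar C0 kS) ?ltn_eqF; try lia.
by case: ifP => i_odd; rewrite !const_k //; lia.
Qed.

Lemma iter_eq_step (T : Type) (f : T -> T) j x y :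
  0 < j -> f x = f y -> iter j f x = iter j f y.
Proof. by case: j => // j _ fxy; rewrite !iterSr fxy. Qed.

(** For prime [C] the last two conditions say that [x] has least period [C]. *)
Definition skew_periodic (C n d e : nat) : {set 'I_(C.*2.+2 ^ n)} :=
  [set x : 'I_(C.*2.+2 ^ n) |
    [&& skew_index C.*2.+1 d (kindex C.*2.+2 n x), kindex C.*2.+2 n x 0 == e,
        iter C (@kaprekar _ n) x == x & kaprekar x != x]].

(** The summands are the excesses of the inner counts over their least admissible value [d + 1], so
    nothing is truncated. *)
Lemma eq_sum_skew_index C d n (x : 'I_(C.*2.+2 ^ n)) :
  skew_index C.*2.+1 d (kindex C.*2.+2 n x) ->
  n = 2 * (kindex C.*2.+2 n x 0 + \sum_(i < C) (kindex C.*2.+2 n x i.+1 - d.+1) + C)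
      + C.*2.+1 * d.
Proof.
move=> kS; have := sum_skew_index kS; rewrite sum_kindex // => {1}->.
have /skew_indexP[_ _ kP] := kS.
have -> : \sum_(i < C) kindex C.*2.+2 n x i.+1 =
    \sum_(i < C) (kindex C.*2.+2 n x i.+1 - d.+1) + C * d.+1.
  rewrite -[C in C * _]card_ord -sum_nat_const -big_split; apply: eq_bigr => i _ /=.
  by have iC := ltn_ord i; have [] := kP i.+1; lia.
lia.
Qed.

(** The bijection [f] lists the excesses of the inner counts. It is injective because [x = T ^ C x]
    depends only on the index, and onto because [T ^ C] of any number with a given index is periodic
    with the same index. Non-fixed points match nonconstant tuples. *)
Lemma card_skew_periodic C d e N n :
  prime C -> pow2_pm1 C.*2.+1 C -> (forall s, 0 < s < C -> ~~ pow2_pm1 C.*2.+1 s) ->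
  0 < e -> n = 2 * (e + N + C) + C.*2.+1 * d ->
  #|skew_periodic C n d e| = C * N_gamma C (N + C).
Proof.
move=> C_pr pC minC e0 def_n; have C0 := prime_gt0 C_pr.
rewrite -card_nonconstant_partitions //.
pose g (x : 'I_(C.*2.+2 ^ n)) i := kindex C.*2.+2 n x i.+1 - d.+1.
pose f x : C.-tuple 'I_N.+1 := [tuple inord (g x i) | i < C].
have sum_g (x : 'I_(C.*2.+2 ^ n)) :
    skew_index C.*2.+1 d (kindex C.*2.+2 n x) -> kindex C.*2.+2 n x 0 = e ->
    \sum_(i < C) g x i = N.
  by move=> kS ke; have := eq_sum_skew_index kS; rewrite ke /g; lia.
have f_val (x : 'I_(C.*2.+2 ^ n)) (i : 'I_C) :
    skew_index C.*2.+1 d (kindex C.*2.+2 n x) -> kindex C.*2.+2 n x 0 = e ->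
    tnth (f x) i = g x i :> nat.
  move=> kS ke; rewrite tnth_mktuple inordK // ltnS -(sum_g x) //.
  by rewrite (bigD1 i) //= leq_addr.
have inj_f : {in skew_periodic C n d e &, injective f}.
  move=> x y; rewrite !inE => /and4P[xS /eqP x0 /eqP xC _] /and4P[yS /eqP y0 /eqP yC _] fxy.
  rewrite -xC -yC; apply: iter_eq_step => //; apply: kaprekar_eq => // v.
  apply: (skew_index_ext xS yS); first by rewrite x0 y0.
  move=> i iC; have i_lt : i.-1 < C by lia.
  have /(congr1 val) := congr1 (fun t => tnth t (Ordinal i_lt)) fxy.
  rewrite /= !f_val // /g /= prednK; last lia.
  have /skew_indexP[_ _ xP] := xS; have /skew_indexP[_ _ yP] := yS.
  have [+ _] := xP i ltac:(lia); have [+ _] := yP i ltac:(lia); lia.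
rewrite -(card_in_imset inj_f); apply: eq_card => t; rewrite inE.
apply/imsetP/andP => [[x]|[/eqP sum_t t_nc]].
  rewrite !inE => /and4P[xS /eqP x0 /eqP xC xT] ->; split.
    by rewrite big_tuple (eq_bigr (fun i : 'I_C => g x i)) ?sum_g // => i _; rewrite f_val.
  apply: contra xT => fx_const; apply/eqP.
  (* Equal inner counts are preserved by [T], hence [T (T x) = T x]; with [T ^ C x = x] this gives
     [T x = x]. *)
  have kTx : kaprekar (kaprekar x) = kaprekar x.
    apply: kaprekar_eq => // v; apply: (kindex_constant_fixed C0 xS) => i iC.
    have /constant_tupleP/(_ (Ordinal (_ : i.-1 < C)) (Ordinal C0))/(congr1 val) := fx_const.
    have i_lt : i.-1 < C by lia.
    move/(_ i_lt); rewrite /= !f_val // /g /= prednK; last lia.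
    have /skew_indexP[_ _ xP] := xS.
    have [+ _] := xP i ltac:(lia); have [+ _] := xP 1 ltac:(lia); lia.
  by rewrite -{2}xC -(iter_eq_step C0 kTx) -iterSr iterS xC.
(* [minn v (B - v)] represents the class of [v] in 1, ..., [C]; its predecessor is the place in
   [t]. *)
pose k v := if v == 0 then e else if v == C.*2.+1 then e + d else
  d.+1 + nth 0 (map val t) (minn v (C.*2.+1 - v)).-1.
have k_inner (i : 'I_C) : k i.+1 = d.+1 + tnth t i.
  have iC := ltn_ord i; rewrite /k /= ltn_eqF; last lia.
  rewrite (_ : (minn _ _).-1 = i); last lia.
  by rewrite (nth_map ord0) ?size_tuple // (tnth_nth ord0).
have kS : skew_index C.*2.+1 d k.
  apply/skew_indexP; rewrite /k /=; split; rewrite ?eqxx // => i iB.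
  rewrite !ifN; try lia.
  by rewrite subKn 1?minnC //; lia.
have [|y kE] := exists_kindex (n := n) C0 kS.
  rewrite (sum_skew_index kS) def_n /(k 0) /=.
  rewrite (eq_bigr (fun i => d.+1 + tnth t i)); last by move=> i _; rewrite k_inner.
  rewrite big_split /= sum_nat_const card_ord; move: sum_t; rewrite big_tuple => ->; lia.
have yS : skew_index C.*2.+1 d (kindex C.*2.+2 n y) by rewrite (skew_index_eq d kE).
(* [y] has the right index but need not be periodic; [T ^ C] takes it to a periodic point with that
   index. *)
have xE := kindex_iter_period C0 pC yS.
set x := iter C (@kaprekar _ n) y in xE.
have xS : skew_index C.*2.+1 d (kindex C.*2.+2 n x) by apply: iter_kaprekar_skew.
have x0 : kindex C.*2.+2 n x 0 = e by rewrite xE // kE.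
exists x.
  rewrite inE xS x0 eqxx /=; apply/andP; split.
    by apply/eqP/iter_eq_step => //; apply: kaprekar_eq => // v; apply: xE.
  apply: contra t_nc => /eqP xT.
  have const_x := kindex_fixed_constant C0 minC xS
    (fun v _ => congr1 (fun x : 'I__ => kindex _ n x v) xT).
  apply/constant_tupleP => i j; have [iC jC] := (ltn_ord i, ltn_ord j).
  apply: val_inj; apply: (@addnI d.+1); rewrite /= -!k_inner -!kE; try lia.
  by rewrite -!xE ?const_x //; lia.
apply: eq_from_tnth => i; apply: val_inj; rewrite /= f_val // /g.
by have iC := ltn_ord i; rewrite xE ?kE ?k_inner ?addKn //; lia.
Qed.

(** At [w = C] the binomial coefficient is 1 and the floor of [1 / C] is 0; below, it is 0 itself.
    Truncated arguments are therefore harmless. *)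
Lemma N_gamma_small C w : 1 < C -> w <= C -> N_gamma C w = 0.
Proof.
move=> C1; rewrite leq_eqVlt => /orP[/eqP->|wC]; first by rewrite /N_gamma binn divn_small.
by rewrite /N_gamma bin_small ?div0n //; lia.
Qed.

Lemma N_kgamma_small C eta : 1 < C -> eta <= C.+1 -> N_kgamma C eta = 0.
Proof.
move=> C1 etaC; rewrite /N_kgamma big_nat_cond big1 // => w /andP[w_eta _].
by apply: N_gamma_small => //; lia.
Qed.

(** The argument of [N_gamma] is [N + C], solved from [n = 2 (e + N + C) + B d]. Without such an [N]
    the set is empty, and either the test fails or the argument is below [C]. *)
Lemma card_skew_periodic_N_gamma C n d e :
  prime C -> pow2_pm1 C.*2.+1 C -> (forall s, 0 < s < C -> ~~ pow2_pm1 C.*2.+1 s) ->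
  #|skew_periodic C n d e| =
  if (0 < e) && (odd n == odd d) then C * N_gamma C ((n - C.*2.+1 * d)./2 - e) else 0.
Proof.
move=> C_pr pC minC; have C1 := prime_gt1 C_pr.
have C0 := prime_gt0 C_pr; set w := _ - e.
have [/and3P[e0 nd Cw]|infeasible] := boolP [&& 0 < e, odd n == odd d & C <= w].
  have def_n : n = 2 * (e + (w - C) + C) + C.*2.+1 * d by rewrite /w in Cw *; lia.
  by rewrite (card_skew_periodic C_pr pC minC e0 def_n) subnK // e0 nd.
rewrite [RHS](_ : _ = 0); last first.
  case: ifP => // /andP[e0 nd]; rewrite N_gamma_small ?muln0 //.
  by move: infeasible; rewrite e0 nd /= -ltnNge => /ltnW.
apply/eqP; rewrite cards_eq0; apply: contraNT infeasible => /set0Pn[x].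
rewrite inE => /and4P[xS /eqP x0 _ _]; have /skew_indexP[e0 _ _] := xS.
have := eq_sum_skew_index xS; rewrite x0 in e0 *; move: (\sum_(i < _) _) => N def_n.
by rewrite e0 /w; lia.
Qed.

(** Setting [w = eta - e] reverses the sum over [e] into the one defining [N_kgamma]; terms with
    [e >= eta] vanish. *)
Lemma sum_card_skew_periodic C n d :
  prime C -> pow2_pm1 C.*2.+1 C -> (forall s, 0 < s < C -> ~~ pow2_pm1 C.*2.+1 s) ->
  \sum_(e < n.+1) #|skew_periodic C n d e| =
  C * ((odd n == odd d) * N_kgamma C ((n - C.*2.+1 * d)./2)).
Proof.
move=> C_pr pC minC; have C1 := prime_gt1 C_pr.
under eq_bigr do rewrite card_skew_periodic_N_gamma //.
set eta := _./2; have eta_n : eta <= n by rewrite /eta; lia.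
case: eqP => _; last by rewrite !muln0 big1 // => e _; rewrite andbF.
rewrite mul1n -(big_mkord xpredT
  (fun e => if (0 < e) && true then C * N_gamma C (eta - e) else 0)).
rewrite big_nat_recl //= add0n -big_distrr /=; congr (C * _).
rewrite /N_kgamma big_add1; case: eta eta_n => [|eta] eta_n /=.
  by rewrite [RHS]big_geq // big1 // => e _; rewrite N_gamma_small //; lia.
rewrite (@big_cat_nat _ _ _ eta) //=; last lia.
rewrite [X in _ + X]big_nat_cond [X in _ + X]big1 ?addn0; last first.
  by move=> e /andP[/andP[e_ge _] _]; rewrite N_gamma_small //; lia.
rewrite big_nat_rev [RHS]big_nat_cond [LHS]big_nat_cond; apply: eq_bigr => e.
by move=> /andP[/andP[_ e_lt] _]; congr (N_gamma C _); lia.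
Qed.

(** * Counting cycles *)

Lemma iter_fixed_gcdn (T : Type) (f : T -> T) m n x :
  iter m f x = x -> iter n f x = x -> iter (gcdn m n) f x = x.
Proof.
case: (posnP m) => [->|m0]; first by rewrite gcd0n.
move=> mx nx; have iter_mul k q : iter q f x = x -> iter (k * q) f x = x.
  by move=> qx; elim: k => // k IHk; rewrite mulSn iterD IHk.
have [km kn def_km _] := egcdnP n m0.
by have := iter_mul km _ mx; rewrite def_km addnC iterD iter_mul.
Qed.

Lemma iter_modn (T : Type) (f : T -> T) p m x :
  iter p f x = x -> iter m f x = iter (m %% p) f x.
Proof.
move=> px; rewrite {1}(divn_eq m p) addnC iterD; congr iter.
by elim: (m %/ p) => // k IHk; rewrite mulSn iterD IHk.
Qed.

(* Each such cycle is the orbit of a non-fixed point; it has length p, which is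
   prime, and these orbits partition the points counted on the right. *)
Lemma card_prime_cycles (T : finType) (f : T -> T) (Q : pred T) p : prime p ->
  (forall x, Q x -> Q (f x)) -> (forall x, Q x -> iter p f (f x) = f x) ->
  #|[set S : {set T} | [&& 2 <= #|S|, [forall x in S, Q x] &
      [exists x in S, (S == [set iter j f x | j : 'I_#|S|]) && (iter #|S| f x == x)]]]| * p =
  #|[set x | [&& Q x, iter p f x == x & f x != x]]|.
Proof.
move=> p_pr Qf pf; have [p0 p1] := (prime_gt0 p_pr, prime_gt1 p_pr).
pose orb x := [set iter j f x | j : 'I_p].
set D := [set x | _].
have iterQ j x : Q x -> Q (iter j f x) by move=> Qx; elim: j => //= j /Qf.
have mem_orb m x : iter p f x = x -> iter m f x \in orb x.
  move=> px; rewrite (iter_modn m px); apply/imsetP.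
  by exists (Ordinal (ltn_pmod m p0)).
have card_orb x : x \in D -> #|orb x| = p.
  rewrite inE => /and3P[Qx /eqP px fx]; rewrite card_imset ?card_ord // => i j.
  wlog ij : i j / i <= j => [W|] e.
    by have /orP[?|?] := leq_total i j; [|symmetry]; apply: W.
  apply: val_inj => /=; apply/eqP; apply: contraNT fx => ne_ij.
  (* Applying [p - i] more steps to equal iterates [i < j < p] gives the period [j - i], which is
     coprime to [p], so [x] would be fixed. *)
  have ji_x : iter (j - i) f x = x.
    have ip := ltnW (ltn_ord i).
    have := congr1 (iter (p - i) f) e; rewrite -!iterD subnK // px => {2}->.
    by rewrite (_ : _ + j = j - i + p) ?iterD ?px //; lia.
  have jp := ltn_ord j; have co : gcdn p (j - i) = 1.
    by apply/eqP; rewrite -/(coprime _ _) prime_coprime // gtnNdvd //; lia.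
  by have := iter_fixed_gcdn px ji_x; rewrite co /= => ->.
have D_orb x y : x \in D -> y \in orb x -> y \in D.
  rewrite inE => /and3P[Qx /eqP px fx] /imsetP[j _ ->].
  rewrite inE iterQ //= -iterD addnC iterD px eqxx /=.
  apply: contra fx => /eqP fj; rewrite -iterS in fj.
  have := congr1 (iter (p - j) f) fj; rewrite -!iterD addnS subnK ?iterS ?px => [->//|].
  exact: ltnW.
have orb_eq x y : x \in D -> y \in orb x -> orb y = orb x.
  move=> xD yx; apply/eqP; rewrite eqEcard !card_orb ?leqnn ?andbT //; last exact: D_orb yx.
  have [j _ ->] := imsetP yx; apply/subsetP=> _ /imsetP[i _ ->].
  by rewrite -iterD mem_orb //; move: xD; rewrite inE => /and3P[_ /eqP].
have self_orb x : x \in D -> x \in orb x.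
  by rewrite inE => /and3P[_ /eqP px _]; rewrite (mem_orb 0).
rewrite (_ : [set S | _] = orb @: D).
  rewrite -[RHS]sum1_card (partition_big_imset orb) /= -sum_nat_const.
  apply: eq_bigr => S /imsetP[x xD ->]; rewrite -(card_orb x xD) -sum1_card.
  apply: eq_bigl => y; apply/idP/andP => [yx|[yD /eqP <-]]; last exact: self_orb.
  by rewrite (orb_eq x) // (D_orb x).
apply/setP=> S; rewrite inE; apply/and3P/imsetP => [[S2 QS]|[x xD ->]].
  case/existsP=> x /andP[xS /andP[/eqP def_S /eqP Sx]].
  have Qx : Q x by have /forallP/(_ x)/implyP/(_ xS) := QS.
  (* [pf] speaks of images under [f]; a point of a cycle is the image of its predecessor. *)
  have px : iter p f x = x.
    rewrite -{1}Sx -(prednK (ltnW S2)) iterSr -iterD addnC iterD pf //.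
    by rewrite -iterSr prednK // ltnW.
  have fx : f x != x.
    apply: contraTN S2 => /eqP fx; rewrite -ltnNge ltnS -(cards1 x) subset_leq_card //.
    rewrite def_S; apply/subsetP=> _ /imsetP[j _ ->].
    by rewrite inE; apply/eqP; elim: (j : nat) => //= i ->.
  exists x; first by rewrite inE Qx px eqxx.
  apply/eqP; rewrite eqEsubset; apply/andP; split; apply/subsetP=> y.
    by rewrite def_S => /imsetP[j _ ->]; apply: mem_orb.
  case/imsetP=> j _ ->; rewrite (iter_modn j Sx).
  have /setP/(_ (iter (j %% #|S|) f x)) -> := def_S; apply/imsetP.
  by exists (Ordinal (ltn_pmod j (ltnW S2))).
rewrite card_orb //; split=> //.
  apply/forallP=> y; apply/implyP=> /(D_orb x y xD).
  by rewrite inE => /andP[].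
apply/existsP; exists x; rewrite self_orb // eqxx /=.
by move: xD; rewrite inE => /and3P[].
Qed.

(** The default [k 1] of the minimum adds no condition, as 1 is in the range. *)
Lemma lt_inner_min B d k :
  1 < B -> (d < inner_min B k) = all (fun i => d < k i) (index_iota 1 B).
Proof.
move=> B1; rewrite /inner_min.
have -> : forall s x, (d < \big[minn/x]_(i <- s) k i) = (d < x) && all (fun i => d < k i) s.
  move=> s x; elim: s => [|i s IHs]; first by rewrite big_nil andbT.
  by rewrite big_cons leq_min IHs /= andbCA.
apply: andb_idl => /allP; apply.
by rewrite mem_index_iota B1.
Qed.

(** The subtraction is truncated, but [skew_index] forces [k B = k 0 + d], so [d = 0] does mean
    [k B = k 0]; the bounds [d < k i] then express fullness. *)
Lemma symmetric_index_skew B k :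
  1 < B -> symmetric_index B k = skew_index B (k B - k 0) k && (k B - k 0 == 0).
Proof.
move=> B1; apply/andP/andP => [[/forallP full /forallP sym]|[/skew_indexP[k0 kB kP] /eqP d0]].
  have k_gt0 i : i <= B -> 0 < k i by move=> iB; apply: (full (Ordinal (iB : i < B.+1))).
  have k_sym i : i <= B -> k (B - i) = k i.
    by move=> iB; apply/eqP/(sym (Ordinal (iB : i < B.+1))).
  have kB : k B = k 0 by rewrite -[LHS]k_sym ?subnn.
  rewrite kB subnn; split=> //; apply/skew_indexP; split; rewrite ?kB ?k_gt0 ?addn0 //.
  by move=> i iB; split; [apply: k_gt0 | apply: k_sym]; lia.
rewrite d0 in kB kP; rewrite addn0 in kB; split; apply/forallP=> -[i /= iB];
  have [->|[->|i_in]] : i = 0 \/ i = B \/ 0 < i < B by lia.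
- by [].
- by rewrite kB.
- by have [] := kP i i_in; lia.
- by rewrite subn0 kB.
- by rewrite subnn kB.
by have [_ ->] := kP i i_in.
Qed.

Lemma almost_symmetric_index_skew B k :
  1 < B ->
  almost_symmetric_index B k = skew_index B (k B - k 0) k && (0 < k B - k 0).
Proof.
move=> B1; apply/and3P/andP.
  move=> [/forallP full /forallP sym /andP[k0B]].
  have k0 : 0 < k 0 := full ord0.
  rewrite -ltn_subLR; last exact: ltnW.
  rewrite lt_inner_min // => /allP d_min.
  rewrite subn_gt0; split=> //; apply/skew_indexP; split=> // [|i iB].
    by rewrite subnKC // ltnW.
  split; first by apply: d_min; rewrite mem_index_iota.
  have iB' : i < B.+1 by lia.
  by have /implyP/(_ _)/eqP := sym (Ordinal iB'); apply=> /=; lia.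
case=> /skew_indexP[k0 kB kP]; set d := k B - k 0 in kB kP * => d0.
split; last 1 first.
- rewrite kB -{1}[k 0]addn0 !ltn_add2l d0 lt_inner_min //.
  by apply/allP=> i; rewrite mem_index_iota => /kP[].
- apply/forallP=> -[i /= iB].
  have [->|[->|i_in]] : i = 0 \/ i = B \/ 0 < i < B by lia.
  + by [].
  + by rewrite kB ltn_addr.
  by have [] := kP i i_in; lia.
apply/forallP=> -[i /= iB]; apply/implyP=> i_in.
by have [|_ ->] := kP i; lia.
Qed.

Lemma kindex_le b n x v : kindex b n x v <= n.
Proof. by rewrite -[X in _ <= X](size_digits b n x) count_size. Qed.

(* Symmetric for R d := (d == 0), almost-symmetric for R d := (0 < d). *)
Definition skew_type (R : pred nat) (C n x : nat) : bool :=
  let k := kindex C.*2.+2 n x in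
  skew_index C.*2.+1 (k C.*2.+1 - k 0) k && R (k C.*2.+1 - k 0).

(** Both 0 and 1 occur as digits. *)
Lemma skew_not_repdigit C d n x :
  0 < C -> skew_index C.*2.+1 d (kindex C.*2.+2 n x) -> ~~ repdigit C.*2.+2 n x.
Proof.
move=> C0 /skew_indexP[k0 _ kP]; have [k1 _] := kP 1 ltac:(lia).
move: k0 (leq_ltn_trans (leq0n d) k1); rewrite /kindex /repdigit -!has_count !has_pred1.
case: (digits _ _ _) => // v s mem0 mem1; apply/negP=> /= /all_pred1P def_s.
by move: mem0 mem1; rewrite def_s !inE !mem_nseq; lia.
Qed.

(** Multiplied by [C], the left side counts the points of least period [C]; these are sorted by [d]
    and then by [k 0] into the sets [skew_periodic]. *)
Lemma card_skew_cycles R C n :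
  prime C -> pow2_pm1 C.*2.+1 C -> (forall s, 0 < s < C -> ~~ pow2_pm1 C.*2.+1 s) ->
  #|[set S : {set 'I_(C.*2.+2 ^ n)} | is_cycle S && [forall x in S, skew_type R C n x]]| =
  \sum_(d < n.+1 | R d) (odd n == odd d) * N_kgamma C ((n - C.*2.+1 * d)./2).
Proof.
move=> C_pr pC minC; have C0 := prime_gt0 C_pr.
apply/eqP; rewrite -(eqn_pmul2r C0); apply/eqP.
pose Q (x : 'I_(C.*2.+2 ^ n)) := skew_type R C n x.
have Q_kaprekar x : Q x -> Q (kaprekar x).
  case/andP=> xS Rx; rewrite /Q /skew_type.
  by rewrite !(kindex_kaprekar_ends C0 xS) ?eqxx ?orbT // kaprekar_skew.
have Q_period x : Q x -> iter C (@kaprekar _ n) (kaprekar x) = kaprekar x.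
  case/andP=> xS _; rewrite -iterSr iterS; apply: kaprekar_eq => // v v_lt.
  exact: (kindex_iter_period C0 pC xS).
rewrite (_ : [set S | _] = [set S : {set 'I_(C.*2.+2 ^ n)} |
    [&& 2 <= #|S|, [forall x in S, Q x] & [exists x in S,
      (S == [set iter j (@kaprekar _ n) x | j : 'I_#|S|]) &&
      (iter #|S| (@kaprekar _ n) x == x)]]]); last first.
  apply/setP=> S; rewrite !inE.
  apply/andP/and3P => [[/and3P[]]|[S2 QS cycS]]; first by split.
  split=> //; apply/and3P; split=> //; apply/forallP=> x; apply/implyP=> xS.
  have /forallP/(_ x)/implyP/(_ xS)/andP[kS _] := QS.
  exact: skew_not_repdigit C0 kS.
rewrite (card_prime_cycles C_pr Q_kaprekar Q_period) -sum1_card.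
pose dif (x : 'I_(C.*2.+2 ^ n)) :=
  kindex C.*2.+2 n x C.*2.+1 - kindex C.*2.+2 n x 0.
have dif_lt x : dif x < n.+1 by rewrite ltnS (leq_trans (leq_subr _ _)) ?kindex_le.
rewrite (partition_big (fun x => Ordinal (dif_lt x)) (fun d : 'I_n.+1 => R d)) /=;
  last first.
  by move=> x; rewrite inE => /and3P[/andP[]].
rewrite big_distrl /=; apply: eq_bigr => d Rd.
rewrite mulnC -(sum_card_skew_periodic n d C_pr pC minC).
have k0_lt (x : 'I_(C.*2.+2 ^ n)) : kindex C.*2.+2 n x 0 < n.+1 by rewrite ltnS kindex_le.
rewrite (partition_big (fun x => Ordinal (k0_lt x)) xpredT) //=.
apply: eq_bigr => e _; rewrite -sum1_card; apply: eq_bigl => x; rewrite !inE -!val_eqE /=.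
rewrite /Q /skew_type -/(dif x); apply/idP/idP.
  by case/andP=> /andP[/and3P[/andP[xS _] -> ->] /eqP <-] ->; rewrite xS.
case/and4P=> xS -> -> ->; have /skew_indexP[_ kB _] := xS.
have -> : dif x = d by rewrite /dif kB addKn.
by rewrite xS Rd eqxx.
Qed.

(** This separates odd from even differences [d]; the parity of [n] keeps only one kind. *)
Lemma big_nat_pairs (F : nat -> nat) K :
  \sum_(1 <= d < K.*2.+1) F d = \sum_(1 <= m < K.+1) (F m.*2.-1 + F m.*2).
Proof.
elim: K => [|K IHK]; first by rewrite !big_geq.
by rewrite doubleS [RHS]big_nat_recr //= -IHK big_nat_recr //= big_nat_recr //= addnA.
Qed.

Lemma big_nat_tail0 (F : nat -> nat) M K :
  M <= K -> (forall m, M < m <= K -> F m = 0) ->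
  \sum_(1 <= m < M.+1) F m = \sum_(1 <= m < K.+1) F m.
Proof.
move=> MK F0; rewrite [RHS](@big_cat_nat _ _ _ M.+1) //= [X in _ + X]big_nat_cond.
by rewrite [X in _ + X]big1 ?addn0 // => m; rewrite andbT => ?; apply: F0; lia.
Qed.

Lemma sigma_min B : odd B ->
  pow2_pm1 B (sigma B) /\ forall s, 0 < s < sigma B -> ~~ pow2_pm1 B s.
Proof.
move=> B_odd; rewrite /sigma; case: ex_minnP => m /andP[_]; rewrite B_odd /= => pm min_m.
split=> // s /andP[s0 sm]; apply: contraTN sm => ps; rewrite -leqNgt.
by apply: min_m; rewrite s0.
Qed.

Theorem mainTheorem5 (b B C n : nat)
    (hb : ~~ odd b) (hB : B = b - 1) (hC : C = (B - 1) %/ 2)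
    (hsigma : sigma B = C) (hCprime : prime C) (hn : 0 < n) :
  [/\ ~~ odd n -> N_SC b n = N_kgamma C (n %/ 2),
      odd n -> N_SC b n = 0,
      odd n ->
        N_AC b n =
        \sum_(1 <= m < ((n - 3) %/ (2 * (b - 1))).+1)
           N_kgamma C ((n - 2 * B * m + B) %/ 2) &
      ~~ odd n ->
        N_AC b n =
        \sum_(1 <= m < ((n - (b + 2)) %/ (2 * (b - 1))).+1)
           N_kgamma C ((n - 2 * B * m) %/ 2)].
Proof.
have C1 := prime_gt1 hCprime.
(* As [C] is positive, no subtraction in the definitions of [B] and [C] is truncated. *)
have def_b : b = C.*2.+2 by lia.
have def_B : B = C.*2.+1 by lia.
clear hb hB hC; subst b B.
have B_odd : odd C.*2.+1 by rewrite /= odd_double.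
have [pC minC] := sigma_min B_odd; rewrite hsigma in pC minC.
have card_SC : N_SC C.*2.+2 n = (odd n == false) * N_kgamma C n./2.
  transitivity (\sum_(d < n.+1 | pred1 0 (d : nat))
    (odd n == odd d) * N_kgamma C ((n - C.*2.+1 * d)./2)).
    rewrite -card_skew_cycles //; apply: eq_card => S; rewrite !inE; congr (_ && _).
    by apply: eq_forallb => x; rewrite symmetric_index_skew //; lia.
  by rewrite (big_pred1 ord0) //= muln0 subn0.
pose G d := (odd n == odd d) * N_kgamma C ((n - C.*2.+1 * d)./2).
have card_AC : N_AC C.*2.+2 n = \sum_(1 <= m < n.+1) (G m.*2.-1 + G m.*2).
  transitivity (\sum_(d < n.+1 | 0 < d) G d).
    rewrite -card_skew_cycles //; apply: eq_card => S; rewrite !inE; congr (_ && _).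
    by apply: eq_forallb => x; rewrite almost_symmetric_index_skew //; lia.
  (* Zero terms extend the range of [d] from [n] to [2n], which splits into pairs [2m - 1], [2m]. *)
  rewrite -big_nat_pairs -(big_nat_tail0 (M := n)); first last.
  - move=> d d_n; have := leq_pmull d (ltn0Sn C.*2).
    by rewrite /G N_kgamma_small ?muln0 //; lia.
  - by lia.
  by rewrite -(big_mkord (leq 1) G) big_ltn_cond //= !big_add1.
split=> n_par.
- by rewrite card_SC (negbTE n_par) mul1n divn2.
- by rewrite card_SC n_par.
(* Only [d = 2m - 1] has the parity of [n]. Beyond the bound, [n - 3 < 2Bm], so the argument of
   [N_kgamma] is at most [C + 1] and the term is 0. *)
- rewrite card_AC -(big_nat_tail0 (M := (n - 3) %/ (2 * (C.*2.+2 - 1)))).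
  + apply: eq_big_nat => -[//|m] /andP[_]; rewrite ltnS leq_divRL ?muln_gt0 // => mM.
    rewrite /G n_par doubleS /= odd_double mul0n addn0 mul1n divn2.
    by congr (N_kgamma C _./2); lia.
  + exact: leq_trans (leq_div _ _) (leq_subr _ _).
  move=> [//|m] /andP[]; rewrite ltn_divLR ?muln_gt0 // => mM _.
  by rewrite /G doubleS /= !N_kgamma_small ?muln0 //; lia.
(* Now only [d = 2m] remains. Beyond the bound, [n - 2Bm < b + 2 = 2C + 4], and the argument is
   again at most [C + 1]. *)
rewrite card_AC -(big_nat_tail0 (M := (n - (C.*2.+2 + 2)) %/ (2 * (C.*2.+2 - 1)))).
- apply: eq_big_nat => -[//|m] /andP[_]; rewrite ltnS leq_divRL ?muln_gt0 // => mM.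
  rewrite /G (negbTE n_par) doubleS /= odd_double mul0n mul1n divn2.
  by congr (N_kgamma C _./2); lia.
- exact: leq_trans (leq_div _ _) (leq_subr _ _).
move=> [//|m] /andP[]; rewrite ltn_divLR ?muln_gt0 // => mM _.
by rewrite /G (negbTE n_par) doubleS /= odd_double mul0n mul1n N_kgamma_small //; lia.
Qed.
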